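(* Let $G$ be the Cartesian product $G_1\Box\,G_2$ of two finite partial cubes $G_1=(V_1,E_1)$ and $G_2=(V_2,E_2)$. Then $$\dim_Z(G)=\dim_Z(G_1)+\dim_Z(G_2).$$
   Context: Graphs are simple, undirected and nonempty. For a set $X$, the hypercube $\mathcal H(X)$ is the graph whose vertices are the finite subsets of $X$, with $P,Q$ adjacent iff $|P\Delta Q|=1$. A graph is a partial cube if it can be isometrically embedded (i.e. by a map preserving shortest-path distances) into some $\mathcal H(X)$. The integer lattice $\mathcal Z^n$ is the graph with vertex set $\mathbb Z^n$ in which two vertices are adjacent iff their $\ell_1$-distance is $1$ (so its graph distance is the $\ell_1$-distance). The lattice dimension $\dim_Z(G)$ of a finite partial cube $G$ is the minimum $n$ such that $G$ is isometrically embeddable into $\mathcal Z^n$ (every finite partial cube is so embeddable for some $n$). The Cartesian product $G_1\Box\,G_2$ has vertex set $V_1\times V_2$, with $(u_1,u_2)$ adjacent to $(v_1,v_2)$ iff either $u_1v_1\in E_1$ and $u_2=v_2$, or $u_1=v_1$ and $u_2v_2\in E_2$. *)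

(* Defs.v *)
From HB Require Import structures.
From mathcomp Require Import all_boot all_order all_algebra.
From mathcomp Require Import finmap.
From mathcomp Require Import boolp classical_sets.

Set Implicit Arguments.
Unset Strict Implicit.
Unset Printing Implicit Defensive.

(* A graph is its adjacency relation [e : rel V]; V need not be finite, so that
   hypercubes and integer lattices are covered as well. *)
Definition simple_graph (V : eqType) (e : rel V) : Prop :=
  [/\ symmetric e, irreflexive e & inhabited V].

Definition walk (V : eqType) (e : rel V) (x y : V) (n : nat) : Prop :=
  exists p : seq V, [/\ path e x p, last x p = y & size p = n].

(* A relation rather than a function: when y is not reachable from x there is
   no such d, i.e. the distance is infinite. *)
Definition graph_dist (V : eqType) (e : rel V) (x y : V) (d : nat) : Prop :=
  walk e x y d /\ (forall m : nat, walk e x y m -> d <= m).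

(* The equivalence also makes f preserve infinite distances. *)
Definition isometric (V W : eqType) (e : rel V) (e' : rel W) (f : V -> W) :
    Prop :=
  forall (x y : V) (d : nat),
    graph_dist e x y d <-> graph_dist e' (f x) (f y) d.

Definition isometrically_embeddable (V W : eqType) (e : rel V) (e' : rel W) :
    Prop :=
  exists f : V -> W, isometric e e' f.

Definition hypercube (X : choiceType) : rel {fset X} :=
  fun P Q => #|` ((P `\` Q) `|` (Q `\` P))%fset| == 1.

Definition partial_cube (V : eqType) (e : rel V) : Prop :=
  exists X : choiceType, isometrically_embeddable e (@hypercube X).

Definition int_lattice (n : nat) : rel 'rV[int]_n :=
  fun x y => \sum_(i < n) `|(x ord0 i - y ord0 i)%R|%N == 1.

Definition lattice_embeddable (V : eqType) (e : rel V) (n : nat) : Prop :=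
  isometrically_embeddable e (@int_lattice n).

Definition is_lattice_dim (V : eqType) (e : rel V) (n : nat) : Prop :=
  lattice_embeddable e n /\
  (forall m : nat, lattice_embeddable e m -> n <= m).

(* The default value 0 is taken only by graphs that embed in no integer
   lattice; no finite partial cube is such a graph. *)
Definition lattice_dim (V : eqType) (e : rel V) : nat :=
  xget 0 (is_lattice_dim e).

Definition cartesian_product (V1 V2 : eqType) (e1 : rel V1) (e2 : rel V2) :
    rel (V1 * V2)%type :=
  fun u v => (e1 u.1 v.1 && (u.2 == v.2)) || ((u.1 == v.1) && e2 u.2 v.2).

(* Main.v *)
Require Import Defs.
From mathcomp Require Import all_boot.
From mathcomp Require Import all_order all_algebra finmap zify.
From mathcomp Require Import boolp classical_sets.

(** Placing two lattice embeddings side by side embeds the product, so only the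
    lower bound needs an idea. In an isometric lattice embedding of the product
    each coordinate is constant along one side of every "rectangle"
    {a, b} x {c, d}. Hence no coordinate varies with both factors, and the sets
    of coordinates that vary with V1, respectively V2, are disjoint. Each of
    them embeds the corresponding factor. *)

Set Implicit Arguments.
Unset Strict Implicit.
Unset Printing Implicit Defensive.

(** * Graph distances as numeric functions, and the metric of a product *)

Definition path_metric (V : eqType) (e : rel V) (D : V -> V -> nat) : Prop :=
  forall x y d, graph_dist e x y d <-> d = D x y.

(** By induction along a walk, the step condition bounds [D x y] by the length of every walk; the
    descent condition builds a walk of exactly that length. Each concrete metric below is verified
    through this local criterion. *)
Lemma path_metricP (V : eqType) (e : rel V) (D : V -> V -> nat) :
  path_metric e D <->
  [/\ forall x y, D x y = 0 <-> x = y,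
      forall x y z, e x z -> D x y <= (D z y).+1
    & forall x y n, D x y = n.+1 -> exists2 z, e x z & D z y = n].
Proof.
split=> [Dm | [D0 Dstep Dpred] x y].
- have distD x y : graph_dist e x y (D x y) by apply/Dm.
  split=> [x y | x y z exz | x y n Dxy].
  + split=> [Dxy | ->].
      by have [[[|? ?] [_ /= + sz]] _] := distD x y; last by rewrite Dxy in sz.
    by have [_ /(_ 0)] := distD y y; rewrite leqn0 => H; apply/eqP/H; exists [::].
  + have [[p [ep lp sp]] _] := distD z y.
    have [_ min_xy] := distD x y.
    by apply: min_xy; exists (z :: p); rewrite /= exz sp.
  + have [[[|z p] [/= ep lp sp]] min_xy] := distD x y; first by rewrite Dxy in sp.
    case/andP: ep => exz ep; exists z => //.
    have {}sp : size p = n by move: sp; rewrite Dxy => -[].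
    apply/esym/Dm; split; first by exists p.
    move=> m [q [eq_ lq sq]]; rewrite -ltnS -Dxy; apply: min_xy.
    by exists (z :: q); rewrite /= exz sq.
- have lower m : forall x', walk e x' y m -> D x' y <= m.
    move=> x' [p [+ + <-]] {m}.
    elim: p x' => [|z p IHp] x' /=; first by move=> _ /D0 ->.
    case/andP=> exz /IHp /[apply] Dz.
    by apply: leq_trans (Dstep _ _ _ exz) _.
  have attained n : forall x', D x' y = n -> walk e x' y n.
    elim: n => [|n IHn] x'; first by move/D0 ->; exists [::].
    case/Dpred=> z exz /IHn[p [ep lp sp]].
    by exists (z :: p); rewrite /= exz sp.
  have distD : graph_dist e x y (D x y).
    by split; [apply: attained | move=> m /lower].
  move=> d; split=> [[wd mind] | -> //].
  by apply/eqP; rewrite eqn_leq lower // andbT; apply: mind; case: distD.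
Qed.

Lemma path_metric_unique (V : eqType) (e : rel V) (D D' : V -> V -> nat) :
  path_metric e D -> path_metric e D' -> D =2 D'.
Proof. by move=> Dm D'm x y; apply/D'm/Dm. Qed.

Lemma eq_path_metric (V : eqType) (e : rel V) (D D' : V -> V -> nat) :
  D =2 D' -> path_metric e D -> path_metric e D'.
Proof. by move=> DD' Dm x y d; rewrite -DD'. Qed.

(** Since [D] is total, an isometric map into such a target forces the source to be connected, with
    the pulled back [D] as its distance. *)
Lemma isometricP (V W : eqType) (e : rel V) (e' : rel W) (D : W -> W -> nat)
    (f : V -> W) :
  path_metric e' D ->
  isometric e e' f <-> path_metric e (fun x y => D (f x) (f y)).
Proof.
move=> Dm; split=> fm x y d; first by rewrite fm.
by rewrite fm Dm.
Qed.

Lemma cartesian_product_metric (V1 V2 : eqType) (e1 : rel V1) (e2 : rel V2)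
    (D1 : V1 -> V1 -> nat) (D2 : V2 -> V2 -> nat) :
  path_metric e1 D1 -> path_metric e2 D2 ->
  path_metric (cartesian_product e1 e2) (fun u v => D1 u.1 v.1 + D2 u.2 v.2).
Proof.
move=> /path_metricP[D10 D1s D1p] /path_metricP[D20 D2s D2p].
apply/path_metricP; split=> [[x1 x2] [y1 y2] | [x1 x2] [y1 y2] [z1 z2] |
  [x1 x2] [y1 y2] n] /=.
- split=> [/eqP | [-> ->]]; last by rewrite (D10 y1 y1).2 ?(D20 y2 y2).2.
  by rewrite addn_eq0 => /andP[/eqP/D10 -> /eqP/D20 ->].
- case/orP=> /andP[/=].
    by move=> /D1s D1z /eqP ->; rewrite -addSn leq_add2r.
  by move=> /eqP -> /D2s D2z; rewrite -addnS leq_add2l.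
(* The geodesic moves in the first factor until it reaches [y1], and only then in the second. *)
- case D1E: (D1 x1 y1) => [|k].
    rewrite add0n => /D2p[z2 e2z D2z]; exists (x1, z2) => /=.
      by rewrite /cartesian_product /= e2z eqxx orbT.
    by rewrite D1E.
  rewrite addSn => -[<-]; have [z1 e1z D1z] := D1p _ _ _ D1E.
  exists (z1, x2); last by rewrite /= D1z.
  by rewrite /cartesian_product /= e1z eqxx.
Qed.

(** * The hypercube metric and its indicator coordinates *)

Section HypercubeMetric.
Local Open Scope fset_scope.

Definition symdiff (X : choiceType) (P Q : {fset X}) : {fset X} :=
  (P `\` Q) `|` (Q `\` P).

Lemma in_symdiff (X : choiceType) (P Q : {fset X}) x :
  (x \in symdiff P Q) = (x \in P) (+) (x \in Q).
Proof. by rewrite /symdiff !inE; case: (x \in P); case: (x \in Q). Qed.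

Lemma hypercube_metric (X : choiceType) :
  path_metric (@hypercube X) (fun P Q => #|` symdiff P Q|).
Proof.
apply/path_metricP; split=> [P Q | P Q R /eqP PR | P Q n PQ].
- split=> [/eqP | ->]; last first.
    apply/eqP; rewrite cardfs_eq0; apply/eqP/fsetP=> x.
    by rewrite in_symdiff addbb inE.
  rewrite cardfs_eq0 => /eqP/fsetP PQ; apply/fsetP=> x.
  by have := PQ x; rewrite in_symdiff inE; case: (x \in P); case: (x \in Q).
(* The 1 is the size of [symdiff P R], and [symdiff P Q] lies in the union of [symdiff P R] and
   [symdiff R Q]. *)
- rewrite -[in leqRHS]add1n -PR -/(symdiff P R).
  rewrite -cardfsUI; apply: leq_trans (leq_addr _ _).
  apply: fsubset_leq_card; apply/fsubsetP=> x; rewrite in_fsetU !in_symdiff.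
  by case: (x \in P); case: (x \in Q); case: (x \in R).
- have /fset0Pn[x xPQ] : symdiff P Q != fset0 by rewrite -cardfs_eq0 PQ.
  (* Toggling an element on which [P] and [Q] disagree moves one edge closer to [Q]. *)
  exists (symdiff P [fset x]).
    rewrite /hypercube -/(symdiff _ _) (_ : symdiff _ _ = [fset x]) ?cardfs1 //.
    by apply/fsetP=> y; rewrite !in_symdiff addbA addbb addFb.
  have -> : symdiff (symdiff P [fset x]) Q = symdiff P Q `\ x.
    apply/fsetP=> y; rewrite in_fsetD1 !in_symdiff in_fset1.
    case: eqP => [-> | _] /=; last by rewrite addbF.
    by move: xPQ; rewrite in_symdiff; case: (x \in P); case: (x \in Q).
  by move: PQ; rewrite (cardfsD1 x) xPQ add1n => -[].
Qed.

(** Indicator vectors turn hypercube distance into l1 distance, with one integer coordinate per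
    element of [S]. *)
Lemma card_symdiff_coord (X : choiceType) (S P Q : {fset X}) :
  P `<=` S -> Q `<=` S ->
  #|` symdiff P Q| =
    \sum_(s : S) `|(Posz (val s \in P) - Posz (val s \in Q))%R|%N.
Proof.
move=> /fsubsetP PS /fsubsetP QS.
have -> : symdiff P Q = [fset x in S | x \in symdiff P Q].
  apply/fsetP=> x; rewrite [LHS]in_symdiff !inE ?in_symdiff /=.
  have := PS x; have := QS x.
  case: (x \in P); case: (x \in Q); rewrite ?andbF ?andbT //=.
    by move=> _ ->.
  by move=> ->.
rewrite card_fset_sum1 big_fset /= big_seq_fsetE /= big_mkcond /=.
apply: eq_bigr => s _; rewrite in_symdiff.
by case: (_ \in P); case: (_ \in Q).
Qed.

End HypercubeMetric.

(** * The l1 metric of the integer lattice *)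

Section LatticeMetric.
Local Open Scope ring_scope.

Definition l1_dist (I : finType) (x y : I -> int) : nat :=
  (\sum_i `|(x i - y i)%R|%N)%N.

(** [Num.sg (b - a)] is the unit step from [a] towards [b]; applied in one coordinate, it gives the
    lattice neighbour that is closer to the target. *)
Lemma absz_step (a b : int) : a != b ->
  `|(a - (a + Num.sg (b - a)))%R|%N = 1%N /\
  `|(a + Num.sg (b - a) - b)%R|.+1%N = `|(a - b)%R|%N.
Proof. lia. Qed.

Lemma int_lattice_metric n :
  path_metric (@int_lattice n) (fun x y => l1_dist (x ord0) (y ord0)).
Proof.
apply/path_metricP; split=> [x y | x y z /eqP xz | x y m xy].
- split=> [/eqP | ->]; last by rewrite /l1_dist big1 // => i _; rewrite GRing.subrr.
  rewrite /l1_dist sum_nat_eq0 => /forallP xy; apply/rowP=> i.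
  by have := xy i; rewrite /= absz_eq0 GRing.subr_eq0 => /eqP.
- rewrite -[in leqRHS]add1n -[X in (_ <= X + _)%N]xz -big_split /=.
  by apply: leq_sum => i _; lia.
- have /existsP[i xyi] : [exists i, x ord0 i != y ord0 i].
    apply: contra_eqT xy => /existsPn xy; rewrite /l1_dist big1 // => i _.
    by have := xy i; lia.
  pose z := \row_j (if j == i then x ord0 i + Num.sg (y ord0 i - x ord0 i)
                    else x ord0 j).
  exists z.
    rewrite /int_lattice (bigD1 i) //= big1 => [|j /negPf ji].
      by rewrite !mxE eqxx (absz_step xyi).1.
    by rewrite mxE ji GRing.subrr.
  apply: succn_inj; rewrite -xy /l1_dist (bigD1 i) //= [in RHS](bigD1 i) //=.
  rewrite mxE eqxx -addSn; congr (_ + _)%N; first exact: (absz_step xyi).2.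
  by apply: eq_bigr => j /negPf ji; rewrite mxE ji.
Qed.

End LatticeMetric.

(** * Lattice embeddings and the lattice dimension *)

Lemma lattice_embeddableP (V : eqType) (e : rel V) n :
  lattice_embeddable e n <->
  exists f : V -> 'I_n -> int, path_metric e (fun x y => l1_dist (f x) (f y)).
Proof.
split=> [[f /(isometricP _ _ (@int_lattice_metric n)) fm] | [f fm]].
  by exists (fun x => f x ord0).
exists (fun x => \row_i f x i)%R; apply/(isometricP _ _ (@int_lattice_metric n)).
apply: eq_path_metric fm => x y.
by apply: eq_bigr => i _; rewrite !mxE.
Qed.

(** Enumerating [A] renumbers the coordinates, so they may be indexed by any finite type and those
    outside [A] discarded. *)
Lemma lattice_embeddable_on (V : eqType) (e : rel V) (I : finType)
    (A : {pred I}) (f : V -> I -> int) :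
  path_metric e (fun x y => \sum_(i in A) `|(f x i - f y i)%R|%N) ->
  lattice_embeddable e #|A|.
Proof.
move=> fm; apply/lattice_embeddableP; exists (fun x i => f x (enum_val i)).
by apply: eq_path_metric fm => x y; rewrite big_enum_val.
Qed.

Lemma partial_cube_lattice_embeddable (V : finType) (e : rel V) :
  partial_cube e -> exists n, lattice_embeddable e n.
Proof.
move=> [X [f /(isometricP _ _ (@hypercube_metric X)) fm]].
(* As [V] is finite, only finitely many elements of [X] occur in the image of [f]; each becomes a
   coordinate. *)
pose S := (\bigcup_(x <- enum V) f x)%fset.
have fS x : (f x `<=` S)%fset by apply: bigfcup_sup; rewrite ?mem_enum.
exists #|{: S}|.
apply: (@lattice_embeddable_on _ _ _ _ (fun x (s : S) => Posz (val s \in f x))).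
by apply: eq_path_metric fm => x y; apply: card_symdiff_coord.
Qed.

(** A single embedding guarantees that a least dimension exists, so [xget] does not fall back on its
    default 0. *)
Lemma lattice_dimP (V : eqType) (e : rel V) n :
  lattice_embeddable e n -> is_lattice_dim e (lattice_dim e).
Proof.
move=> en; apply: xgetPex.
have ex : exists m, `[< lattice_embeddable e m >] by exists n; apply/asboolP.
case: (ex_minnP ex) => m /asboolP em min_m.
by exists m; split=> // k /asboolP/min_m.
Qed.

Lemma lattice_embeddable_product (V1 V2 : eqType) (e1 : rel V1) (e2 : rel V2)
    n1 n2 :
  lattice_embeddable e1 n1 -> lattice_embeddable e2 n2 ->
  lattice_embeddable (cartesian_product e1 e2) (n1 + n2).
Proof.
move=> /lattice_embeddableP[f1 fm1] /lattice_embeddableP[f2 fm2].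
apply/lattice_embeddableP.
exists (fun u i => match split i with inl j => f1 u.1 j | inr k => f2 u.2 k end).
apply: eq_path_metric (cartesian_product_metric fm1 fm2) => u v /=.
rewrite [RHS]big_split_ord /=; congr (_ + _); apply: eq_bigr => i _.
  by rewrite (unsplitK (inl i)).
by rewrite (unsplitK (inr i)).
Qed.

(** * Rectangles and the lower bound *)

(** The triangle inequality holds in each coordinate, so equality of the sums makes every coordinate
    tight. *)
Lemma l1_dist_between (I : finType) (x y z : I -> int) :
  l1_dist x z = l1_dist x y + l1_dist y z ->
  forall i, `|(x i - z i)%R|%N = `|(x i - y i)%R|%N + `|(y i - z i)%R|%N.
Proof.
rewrite /l1_dist -big_split /= => xyz i.
have le_sum j : true ->
    `|(x j - z j)%R|%N <= `|(x j - y j)%R|%N + `|(y j - z j)%R|%N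
      ?= iff (`|(x j - z j)%R|%N == `|(x j - y j)%R|%N + `|(y j - z j)%R|%N).
  by move=> _; split; first lia.
have [_] := leqif_sum le_sum.
by rewrite xyz eqxx => /esym/forallP/(_ i)/eqP.
Qed.

(* In an l1-embedded product "rectangle" each diagonal is metrically spanned
   through both other corners, which forces every coordinate to be constant
   along one of the two directions. *)
Lemma rectangle_coord (V1 V2 : Type) (I : finType) (D1 : V1 -> V1 -> nat)
    (D2 : V2 -> V2 -> nat) (f : V1 * V2 -> I -> int) :
  (forall a, D1 a a = 0) -> (forall c, D2 c c = 0) ->
  (forall u v, l1_dist (f u) (f v) = D1 u.1 v.1 + D2 u.2 v.2) ->
  forall a b c d i,
    (f (a, c) i = f (b, c) i /\ f (a, d) i = f (b, d) i) \/
    (f (a, c) i = f (a, d) i /\ f (b, c) i = f (b, d) i).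
Proof.
move=> D10 D20 fD a b c d i.
have /l1_dist_between/(_ i) H1 : l1_dist (f (a, c)) (f (b, d)) =
    l1_dist (f (a, c)) (f (b, c)) + l1_dist (f (b, c)) (f (b, d)).
  by rewrite !fD /= D10 D20; lia.
have /l1_dist_between/(_ i) H2 : l1_dist (f (a, c)) (f (b, d)) =
    l1_dist (f (a, c)) (f (a, d)) + l1_dist (f (a, d)) (f (b, d)).
  by rewrite !fD /= D10 D20; lia.
have /l1_dist_between/(_ i) H3 : l1_dist (f (a, d)) (f (b, c)) =
    l1_dist (f (a, d)) (f (a, c)) + l1_dist (f (a, c)) (f (b, c)).
  by rewrite !fD /= D10 D20; lia.
have /l1_dist_between/(_ i) H4 : l1_dist (f (a, d)) (f (b, c)) =
    l1_dist (f (a, d)) (f (b, d)) + l1_dist (f (b, d)) (f (b, c)).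
  by rewrite !fD /= D10 D20; lia.
(* By [H1] to [H4] the values at the ends of the two diagonals span the same interval, hence are the
   same pair of integers; the two ways of matching them are the two disjuncts. *)
by lia.
Qed.

Lemma lattice_embeddable_factors (V1 V2 : finType) (e1 : rel V1) (e2 : rel V2)
    (D1 : V1 -> V1 -> nat) (D2 : V2 -> V2 -> nat) (a0 : V1) (c0 : V2) n :
  path_metric e1 D1 -> path_metric e2 D2 ->
  lattice_embeddable (cartesian_product e1 e2) n ->
  exists n1 n2, [/\ lattice_embeddable e1 n1, lattice_embeddable e2 n2
                  & n1 + n2 <= n].
Proof.
move=> Dm1 Dm2 /lattice_embeddableP[f fm].
have fD := path_metric_unique fm (cartesian_product_metric Dm1 Dm2).
have D10 a : D1 a a = 0 by case/path_metricP: (Dm1) => /(_ a a)[_ ->].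
have D20 c : D2 c c = 0 by case/path_metricP: (Dm2) => /(_ c c)[_ ->].
have rect := rectangle_coord D10 D20 fD.
pose A1 := [set i | [exists a, exists b, exists c, f (a, c) i != f (b, c) i]].
pose A2 := [set i | [exists a, exists c, exists d, f (a, c) i != f (a, d) i]].
have A12 : [disjoint A1 & A2].
  apply/pred0P=> i; apply/negbTE/negP=> /andP[]; rewrite !inE.
  case/existsP=> a /existsP[b /existsP[c /eqP ab]].
  case/existsP=> a' /existsP[c' /existsP[d' /eqP cd]].
  (* By [ab], the first two rectangles force [f (a, c') i] and [f (a, d') i] to equal [f (a, c) i];
     the third carries their equality over to [a'], against [cd]. *)
  have := rect a b c c' i; have := rect a b c d' i; have := rect a' a c' d' i.
  intuition congruence.
exists #|A1|, #|A2|; split.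
(* On the slice of the product at [c0], coordinates outside [A1] are constant and contribute nothing
   to the distance. *)
- apply: (@lattice_embeddable_on _ _ _ _ (fun a => f (a, c0))).
  apply: eq_path_metric Dm1 => a b.
  have := fD (a, c0) (b, c0); rewrite /= D20 addn0 => <-.
  rewrite /l1_dist (bigID (mem A1)) /= [X in _ + X]big1 ?addn0 // => i.
  rewrite inE => /existsPn/(_ a)/existsPn/(_ b)/existsPn/(_ c0).
  by rewrite negbK => /eqP ->; lia.
- apply: (@lattice_embeddable_on _ _ _ _ (fun c => f (a0, c))).
  apply: eq_path_metric Dm2 => c d.
  have := fD (a0, c) (a0, d); rewrite /= D10 add0n => <-.
  rewrite /l1_dist (bigID (mem A2)) /= [X in _ + X]big1 ?addn0 // => i.
  rewrite inE => /existsPn/(_ a0)/existsPn/(_ c)/existsPn/(_ d).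
  by rewrite negbK => /eqP ->; lia.
- have := leq_card_setU A1 A2; rewrite A12 => -[_ /eqP <-].
  by rewrite -[leqRHS]card_ord max_card.
Qed.

Theorem theorem6p2 (V1 V2 : finType) (E1 : rel V1) (E2 : rel V2)
    (G1_graph : simple_graph E1) (G2_graph : simple_graph E2)
    (G1_cube : partial_cube E1) (G2_cube : partial_cube E2) :
  lattice_dim (cartesian_product E1 E2) = lattice_dim E1 + lattice_dim E2.
Proof.
have [_ _ [a0]] := G1_graph; have [_ _ [c0]] := G2_graph.
have [n1 /lattice_dimP[emb1 min1]] := partial_cube_lattice_embeddable G1_cube.
have [n2 /lattice_dimP[emb2 min2]] := partial_cube_lattice_embeddable G2_cube.
have emb12 := lattice_embeddable_product emb1 emb2.
have [emb min12] := lattice_dimP emb12.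
(* [min12] applied to [emb12] is the upper bound. For the other inequality an optimal embedding of
   the product is split, with [fm1] and [fm2] supplying the distances of the factors. *)
apply/eqP; rewrite eqn_leq min12 //=.
have [f1 fm1] := (lattice_embeddableP _ _).1 emb1.
have [f2 fm2] := (lattice_embeddableP _ _).1 emb2.
have [m1 [m2 [/min1 le1 /min2 le2]]] :=
  lattice_embeddable_factors a0 c0 fm1 fm2 emb.
exact/leq_trans/leq_add.
Qed.
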